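(* Let $X_{\infty}$ be an indecomposable complex Banach space such that the unital Banach algebras $\mathcal{B}(X_{\infty})/\mathcal{K}(X_{\infty})$ and $\ell_1(\mathbb{N}_0)$ are isometrically isomorphic (the space constructed by Tarbard). Then the Banach algebra $\mathcal{B}(X_{\infty})$ is Dedekind-finite but does not have stable rank one.
   Context: All Banach spaces are over $\mathbb{C}$. For a Banach space $X$, $\mathcal{B}(X)$ is the unital Banach algebra of bounded linear operators on $X$ with the operator norm, and $\mathcal{K}(X)$ is its closed two-sided ideal of compact operators. An infinite-dimensional Banach space $X$ is indecomposable if there are no closed, infinite-dimensional subspaces $Y,Z$ of $X$ with $X=Y+Z$ and $Y\cap Z=\{0\}$. $\mathbb{N}_0=\{0,1,2,\dots\}$, and $\ell_1(\mathbb{N}_0)$ is the complex unital Banach algebra of absolutely summable complex sequences indexed by $\mathbb{N}_0$ with the $\ell_1$-norm and the convolution product $(a*b)_m=\sum_{k=0}^m a_k b_{m-k}$. Two idempotents $p,q$ in a ring $A$ are equivalent, $p\sim q$, if there are $a,b\in A$ with $ab=p$ and $ba=q$. A unital ring $A$ is Dedekind-finite if the only idempotent $p\in A$ with $p\sim 1_A$ is $p=1_A$. A unital Banach algebra $A$ has stable rank one if its group of invertible elements $\mathrm{inv}(A)$ is norm-dense in $A$. The existence of a space $X_\infty$ as in the claim is a theorem of Tarbard (Ph.D. Thesis, University of Oxford, 2013). *)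

(* Defs.v *)
From HB Require Import structures.
From mathcomp Require Import all_boot all_order all_algebra complex.
From mathcomp Require Import generic_quotient ring_quotient.
From mathcomp Require Import all_classical all_reals all_analysis.
From mathcomp Require Import lra.

Set Implicit Arguments.
Unset Strict Implicit.
Unset Printing Implicit Defensive.

Import Order.TTheory GRing.Theory Num.Theory numFieldNormedType.Exports.
Import ComplexField.Normc.

Local Open Scope classical_set_scope.
Local Open Scope ring_scope.
Local Open Scope complex_scope.
Local Open Scope quotient_scope.

(* A possibly zero unital normed algebra over K.  The ssralg structure algType
   is not usable here: it requires 1 != 0, which fails for B(0) and for
   B(X)/K(X) with X finite-dimensional. *)
HB.mixin Record NormedModule_isNormedAlgebra (K : numFieldType) A
    of NormedModule K A := {
  nalg_one : A ;
  nalg_mul : A -> A -> A ;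
  nalg_mulrA : associative nalg_mul ;
  nalg_mul1r : left_id nalg_one nalg_mul ;
  nalg_mulr1 : right_id nalg_one nalg_mul ;
  nalg_mulrDl : left_distributive nalg_mul +%R ;
  nalg_mulrDr : right_distributive nalg_mul +%R ;
  nalg_scalerAl : forall (k : K) (x y : A),
    k *: nalg_mul x y = nalg_mul (k *: x) y ;
  nalg_scalerAr : forall (k : K) (x y : A),
    k *: nalg_mul x y = nalg_mul x (k *: y) ;
  nalg_normrM_le : forall x y : A, `|nalg_mul x y| <= `|x| * `|y|
}.

#[short(type="normedAlgType")]
HB.structure Definition NormedAlgebra (K : numFieldType) :=
  {A of NormedModule K A & NormedModule_isNormedAlgebra K A}.

HB.instance Definition _ (K : numFieldType) (A : normedAlgType K) :=
  GRing.Zmodule_isPzRing.Build (NormedAlgebra.sort A)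
    (@nalg_mulrA K A) (@nalg_mul1r K A) (@nalg_mulr1 K A)
    (@nalg_mulrDl K A) (@nalg_mulrDr K A).

Section algebra_notions.

Definition idempotent_elt (A : pzRingType) (p : A) := p * p = p.

Definition idem_equiv (A : pzRingType) (p q : A) :=
  exists a b : A, a * b = p /\ b * a = q.

Definition dedekind_finite (A : pzRingType) :=
  forall p : A, idempotent_elt p -> idem_equiv p 1 -> p = 1.

Definition inv_group (A : pzRingType) : set A :=
  [set a | exists b : A, a * b = 1 /\ b * a = 1].

Definition stable_rank_one (K : numFieldType) (A : normedAlgType K) :=
  dense (@inv_group A).

Definition isometrically_isomorphic (K : numFieldType)
    (A B : normedAlgType K) :=
  exists phi : {rmorphism A -> B},
    [/\ scalable phi, bijective phi & forall a : A, `|phi a| = `|a| ].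

End algebra_notions.

Section rnorm.
Variables (R : realType) (V : normedModType R[i]).
Implicit Types x y : V.

(* Library norms on a complex space are valued in R[i]; suprema and infima
   exist only in R. *)
Definition rnorm x : R := complex.Re `|x|.

Lemma rnormE x : (rnorm x)%:C = `|x|.
Proof. by rewrite /rnorm RRe_real// realE normr_ge0. Qed.

Lemma rnorm_ge0 x : 0 <= rnorm x.
Proof. by rewrite -lecR rnormE normr_ge0. Qed.

Lemma rnorm0 : rnorm 0 = 0.
Proof. by rewrite /rnorm normr0. Qed.

Lemma rnorm_eq0 x : rnorm x = 0 -> x = 0.
Proof. by move=> x0; apply/normr0_eq0; rewrite -rnormE x0. Qed.

Lemma ler_rnormD x y : rnorm (x + y) <= rnorm x + rnorm y.
Proof. by rewrite -lecR rmorphD/= !rnormE ler_normD. Qed.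

Lemma rnormN x : rnorm (- x) = rnorm x.
Proof. by rewrite /rnorm normrN. Qed.

Lemma rnormZ (k : R[i]) x : rnorm (k *: x) = normc k * rnorm x.
Proof.
by apply: complexI; rewrite rmorphM/= !rnormE normrZ.
Qed.

End rnorm.

Section bounded_operators.
Variables (R : realType) (X : normedModType R[i]).

Definition bounded_op : {pred X -> X} := fun f =>
  `[< linear f /\ exists M : R, forall x, rnorm (f x) <= M * rnorm x >].

Lemma bounded_op_submod : submod_closed bounded_op.
Proof.
split=> [|k f g /asboolP[fl [M fM]] /asboolP[gl [N gN]]]; apply/asboolP; split.
- by move=> k x y; rewrite scaler0 addr0.
- by exists 0 => x; rewrite mul0r rnorm0.
- move=> c x y; rewrite !fctE fl gl !scalerDr !scalerA mulrC.
  by rewrite -!addrA; congr (_ + _); rewrite addrCA.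
- exists (normc k * M + N) => x; apply: (le_trans (ler_rnormD _ _)).
  rewrite mulrDl lerD// rnormZ -mulrA ler_wpM2l//.
  by case: k => ? ?; exact: sqrtr_ge0.
Qed.

HB.instance Definition _ :=
  GRing.isSubmodClosed.Build R[i] (X -> X) bounded_op bounded_op_submod.

Record bop := Bop { bop_fun :> X -> X ; bop_subproof : bop_fun \in bounded_op }.

HB.instance Definition _ := [isSub for bop_fun].
HB.instance Definition _ := [Choice of bop by <:].
HB.instance Definition _ := [SubChoice_isSubLmodule of bop by <:].

Lemma bopP (f g : bop) : f =1 g -> f = g.
Proof. by move=> fg; apply/val_inj/funext. Qed.

Lemma bop_linear (f : bop) : linear f.
Proof. by case: f => f /= /asboolP[]. Qed.

Lemma bop_bounded (f : bop) :
  exists M : R, forall x, rnorm (f x) <= M * rnorm x.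
Proof. by case: f => f /= /asboolP[]. Qed.

Lemma bop0 (f : bop) : f 0 = 0.
Proof.
by rewrite -[0 in LHS](subrr 0) -scaleN1r addrC bop_linear scaleN1r addNr.
Qed.

Lemma bopD (f : bop) x y : f (x + y) = f x + f y.
Proof. by rewrite -[x in LHS]scale1r bop_linear scale1r. Qed.

Lemma bopB (f : bop) x y : f (x - y) = f x - f y.
Proof. by rewrite addrC -scaleN1r bop_linear scaleN1r addrC. Qed.

Lemma bopZ (f : bop) k x : f (k *: x) = k *: f x.
Proof. by rewrite -[k *: x]addr0 bop_linear bop0 addr0. Qed.

Lemma bop_comp_subproof (f g : bop) : (f \o g) \in bounded_op.
Proof.
apply/asboolP; split=> [k x y /=|]; first by rewrite !bop_linear.
have [M fM] := bop_bounded f; have [N gN] := bop_bounded g.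
exists (`|M| * N) => x /=; apply: (le_trans (fM _)).
apply: (@le_trans _ _ (`|M| * rnorm (g x))).
  by rewrite ler_wpM2r ?rnorm_ge0 ?ler_norm.
by rewrite -mulrA ler_wpM2l.
Qed.

Definition bop_comp f g := Bop (bop_comp_subproof f g).

Lemma bop_id_subproof : id \in bounded_op.
Proof. by apply/asboolP; split=> //; exists 1 => x; rewrite mul1r. Qed.

Definition bop_id := Bop bop_id_subproof.

Definition opnorm (f : bop) : R :=
  sup [set rnorm (f x) | x in [set x : X | rnorm x <= 1]].

Lemma opnorm_has_sup (f : bop) :
  has_sup [set rnorm (f x) | x in [set x : X | rnorm x <= 1]].
Proof.
split; first by exists (rnorm (f 0)), 0 => //=; rewrite rnorm0.
have [M fM] := bop_bounded f; exists `|M| => _ [x /= x1 <-].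
apply: (le_trans (fM _)); apply: (@le_trans _ _ (`|M| * rnorm x)).
  by rewrite ler_wpM2r ?rnorm_ge0 ?ler_norm.
by rewrite -[leRHS]mulr1 ler_wpM2l.
Qed.

Lemma opnorm_ub (f : bop) x : rnorm x <= 1 -> rnorm (f x) <= opnorm f.
Proof.
by move=> x1; apply: ub_le_sup; [exact: (opnorm_has_sup f).2|exists x].
Qed.

Lemma opnorm_le (f : bop) M :
  (forall x, rnorm x <= 1 -> rnorm (f x) <= M) -> opnorm f <= M.
Proof.
move=> fM; apply: ge_sup; first exact: (opnorm_has_sup f).1.
by move=> _ [x x1 <-]; exact: fM.
Qed.

Lemma opnorm_ge0 (f : bop) : 0 <= opnorm f.
Proof.
by apply: le_trans (rnorm_ge0 _) (@opnorm_ub f 0 _); rewrite rnorm0.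
Qed.

Lemma rnormZr (r : R) (x : X) : 0 <= r -> rnorm (r%:C *: x) = r * rnorm x.
Proof. by move=> r0; rewrite rnormZ /= expr0n addr0 sqrtr_sqr ger0_norm. Qed.

Lemma opnormP (f : bop) x : rnorm (f x) <= opnorm f * rnorm x.
Proof.
have [x0|x0] := eqVneq (rnorm x) 0.
  by rewrite (rnorm_eq0 x0) bop0 rnorm0 mulr0.
have xgt0 : 0 < rnorm x by rewrite lt_def x0 rnorm_ge0.
rewrite -ler_pdivrMr// mulrC -rnormZr ?invr_ge0 ?rnorm_ge0// -bopZ.
by apply: opnorm_ub; rewrite rnormZr ?invr_ge0 ?rnorm_ge0// mulVf.
Qed.

Definition bop_norm (f : bop) : R[i] := (opnorm f)%:C.

Lemma bop_normD f g : bop_norm (f + g) <= bop_norm f + bop_norm g.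
Proof.
rewrite /bop_norm -rmorphD/= lecR; apply: opnorm_le => x x1.
by apply: (le_trans (ler_rnormD _ _)); rewrite lerD ?opnorm_ub.
Qed.

Lemma bop_normZ k f : bop_norm (k *: f) = `|k| * bop_norm f.
Proof.
have le1 c g : opnorm (c *: g) <= normc c * opnorm g.
  apply: opnorm_le => x x1; rewrite /= rnormZ ler_wpM2l ?opnorm_ub//.
  by case: c => ? ?; exact: sqrtr_ge0.
rewrite /bop_norm; suff -> : opnorm (k *: f) = normc k * opnorm f by exact: rmorphM.
apply/eqP; rewrite eq_le le1 /=.
have [->|k0] := eqVneq k 0; first by rewrite normc0 mul0r opnorm_ge0.
have kgt0 : 0 < normc k.
  rewrite lt_def; apply/andP; split; last by case: (k) => ? ?; exact: sqrtr_ge0.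
  by apply/eqP => /eq0_normc; exact/eqP.
rewrite mulrC -ler_pdivlMr// mulrC -normcV.
by apply: le_trans (le1 _ _); rewrite scalerA mulVf// scale1r.
Qed.

Lemma bop_norm0_eq0 f : bop_norm f = 0 -> f = 0.
Proof.
move=> [f0]; apply: bopP => x; apply: rnorm_eq0; apply/eqP.
by rewrite eq_le rnorm_ge0 andbT -[leRHS](mul0r (rnorm x)) -f0 opnormP.
Qed.

HB.instance Definition _ :=
  Lmodule_isNormed.Build R[i] bop bop_normD bop_normZ bop_norm0_eq0.

Lemma bop_normE (f : bop) : `|f| = (opnorm f)%:C.
Proof. by []. Qed.

Lemma bop_compA : associative bop_comp. Proof. by move=> f g h; exact: bopP. Qed.
Lemma bop_comp1f : left_id bop_id bop_comp. Proof. by move=> f; exact: bopP. Qed.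
Lemma bop_compf1 : right_id bop_id bop_comp. Proof. by move=> f; exact: bopP. Qed.
Lemma bop_compDl : left_distributive bop_comp +%R.
Proof. by move=> f g h; exact: bopP. Qed.
Lemma bop_compDr : right_distributive bop_comp +%R.
Proof.
by move=> f g h; apply: bopP => x; exact: bopD.
Qed.
Lemma bop_scaleAl k f g : k *: bop_comp f g = bop_comp (k *: f) g.
Proof. exact: bopP. Qed.
Lemma bop_scaleAr k f g : k *: bop_comp f g = bop_comp f (k *: g).
Proof. by apply: bopP => x /=; rewrite bopZ. Qed.

Lemma bop_normM f g : `|bop_comp f g| <= `|f| * `|g|.
Proof.
rewrite !bop_normE -rmorphM/= lecR; apply: opnorm_le => x x1 /=.
apply: (le_trans (opnormP _ _)); rewrite ler_wpM2l ?opnorm_ge0//.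
exact: opnorm_ub.
Qed.

HB.instance Definition _ := NormedModule_isNormedAlgebra.Build R[i] bop
  bop_compA bop_comp1f bop_compf1 bop_compDl bop_compDr
  bop_scaleAl bop_scaleAr bop_normM.
HB.instance Definition _ := GRing.PzRing.copy bop (NormedAlgebra.sort bop).

Lemma bop_mulE (f g : bop) x : (f * g) x = f (g x). Proof. by []. Qed.
Lemma bop_oneE x : (1 : bop) x = x. Proof. by []. Qed.
Lemma bop_addE (f g : bop) x : (f + g) x = f x + g x. Proof. by []. Qed.
Lemma bop_scaleE k (f : bop) x : (k *: f) x = k *: f x. Proof. by []. Qed.

End bounded_operators.

Section compact_operators.
Variables (R : realType) (X : completeNormedModType R[i]).
Implicit Types S T : bop X.

Let B : set X := [set x | rnorm x <= 1].

Definition compact_op : {pred bop X} := fun T =>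
  `[< compact (closure [set T x | x in [set x : X | rnorm x <= 1]]) >].

Let compact_op_sub T C :
  compact C -> [set T x | x in B] `<=` C -> T \in compact_op.
Proof.
move=> cC TC; apply/asboolP; rewrite -precompactE.
apply: precompact_subset TC _.
by apply: compact_precompact => //; exact: norm_hausdorff.
Qed.

Let compact_opP T : T \in compact_op ->
  exists2 C : set X, compact C & [set T x | x in B] `<=` C.
Proof.
by move=> /asboolP cT; exists (closure (T @` B)) => //; exact: subset_closure.
Qed.

Let nbhs_rnorm (x : X) (A : set X) :
  nbhs x A <-> exists2 e : R, 0 < e & forall y, rnorm (x - y) < e -> A y.
Proof.
split=> [/nbhs_ballP[e /= e0 eA]|[e e0 eA]].
  exists (complex.Re e); first by rewrite -ltcR RRe_real// realE ltW.
  move=> y xy; apply: eA; rewrite -ball_normE /ball_/= -rnormE.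
  by rewrite -[e]RRe_real ?ltcR// realE ltW.
apply/nbhs_ballP; exists e%:C => /=; first by rewrite ltcR.
by move=> y; rewrite -ball_normE /ball_/= -rnormE ltcR; exact: eA.
Qed.

Let bop_continuous T : continuous T.
Proof.
have [M TM] := bop_bounded T.
move=> x A /= /nbhs_rnorm[e e0 eA]; apply/nbhs_rnorm.
have M0 : 0 < `|M| + 1 by rewrite ltr_wpDl.
exists (e / (`|M| + 1)); first by rewrite divr_gt0.
move=> y xy; apply: eA; rewrite -bopB; apply: (le_lt_trans (TM _)).
apply: (@le_lt_trans _ _ ((`|M| + 1) * rnorm (x - y))); last first.
  by rewrite mulrC -ltr_pdivlMr.
by rewrite ler_wpM2r ?rnorm_ge0// (le_trans (ler_norm M))// lerDl.
Qed.

Lemma compact_op0 : 0 \in compact_op.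
Proof.
apply: (compact_op_sub (@compact_set1 X 0)).
by move=> _ [x _ <-].
Qed.

Lemma compact_op_linear k S T :
  S \in compact_op -> T \in compact_op -> k *: S + T \in compact_op.
Proof.
move=> /compact_opP[C cC SC] /compact_opP[D cD TD].
pose h (z : X * X) := k *: z.1 + z.2.
have hc : continuous h.
  move=> z; apply: (@cvgD _ _ _ _ _ (fun z : X * X => k *: z.1) snd).
    by apply: cvgZr; exact: cvg_fst.
  exact: cvg_snd.
apply: (@compact_op_sub _ (h @` (C `*` D))).
  by apply: continuous_compact; [exact: continuous_subspaceT|exact: compact_setX].
move=> _ [x x1 <-]; exists (S x, T x) => //; split.
  by apply: SC; exists x.
by apply: TD; exists x.
Qed.

Lemma compact_op_submod : submod_closed compact_op.
Proof. by split=> [|k S T]; [exact: compact_op0|exact: compact_op_linear]. Qed.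

Lemma compact_op_zmod : zmod_closed compact_op.
Proof. exact: GRing.submod_closedB compact_op_submod. Qed.

HB.instance Definition _ :=
  GRing.isZmodClosed.Build (bop X) compact_op compact_op_zmod.

Lemma compact_opZ k S : S \in compact_op -> k *: S \in compact_op.
Proof.
move=> Sc; rewrite -[k *: S]addr0; apply: compact_op_linear => //.
exact: compact_op0.
Qed.

Lemma compact_opMl T S : S \in compact_op -> T * S \in compact_op.
Proof.
move=> /compact_opP[C cC SC]; apply: (@compact_op_sub _ (T @` C)).
  by apply: continuous_compact => //; exact: continuous_subspaceT.
by move=> _ [x x1 <-]; exists (S x) => //; apply: SC; exists x.
Qed.

Lemma compact_opMr T S : S \in compact_op -> S * T \in compact_op.
Proof.
move=> /compact_opP[C cC SC].
pose r : R := opnorm T + 1.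
have r0 : 0 < r by rewrite ltr_wpDl ?opnorm_ge0.
apply: (@compact_op_sub _ ((fun x => r%:C *: x) @` C)).
  apply: continuous_compact => //; apply: continuous_subspaceT.
  exact: scaler_continuous.
move=> _ [x x1 <-]; exists (S (r^-1%:C *: T x)); last first.
  by rewrite -bopZ scalerA -rmorphM/= mulfV ?gt_eqF// scale1r.
apply: SC; exists (r^-1%:C *: T x) => //=.
suff : rnorm (r^-1%:C *: T x) <= 1 by [].
have rV0 : 0 <= r^-1 by rewrite invr_ge0 ltW.
rewrite rnormZr// ler_pdivrMl// mulr1.
by rewrite (le_trans (opnorm_ub _ x1))// /r lerDl.
Qed.

Lemma compact_op_closed T :
  (forall e : R, 0 < e -> exists2 S, S \in compact_op & opnorm (T - S) < e) ->
  T \in compact_op.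
Proof.
move=> Tlim; apply/asboolP; rewrite compact_ultra => F FU FT.
have key (e : R) : 0 < e -> exists p, F [set y | rnorm (p - y) < e].
  move=> e0; have e40 : 0 < e / 4 by rewrite divr_gt0.
  have [S /compact_opP[C cC SC] TS] := Tlim _ e40.
  pose G := filter_from F (fun A =>
    [set c | C c /\ exists2 y, A y & rnorm (c - y) < e / 2]).
  have GF : ProperFilter G.
    apply: filter_from_proper.
      apply: filter_from_filter; first by exists setT; exact: filterT.
      move=> A A' FA FA'; exists (A `&` A'); first exact: filterI.
      by move=> c [Cc [y [Ay A'y] cy]]; split; split=> //; exists y.
    move=> A FA; have [y [Ay yT]] := filter_ex (filterI FA FT).
    have [|_ [[x x1 <-] yTx]] := yT [set z | rnorm (y - z) < e / 4].
      by apply/nbhs_rnorm; exists (e / 4).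
    exists (S x); split; first by apply: SC; exists x.
    exists y => //; rewrite -rnormN opprB.
    have -> : y - S x = (y - T x) + (T x - S x) by rewrite addrA subrK.
    apply: (le_lt_trans (ler_rnormD _ _)).
    have := opnorm_ub (T - S) x1; move: yTx => /= h1 h2; move: TS h2.
    rewrite [rnorm ((T - S) x)](_ : _ = rnorm (T x - S x)) //.
    move: h1; lra.
  have GC : G C by exists setT; [exact: filterT|move=> c []].
  have [p [_ pG]] := cC G GF GC.
  exists p; have [//|FN] := in_ultra_setVsetC [set y | rnorm (p - y) < e] FU.
  pose N := [set c | C c /\
    exists2 y, (~` [set y | rnorm (p - y) < e]) y & rnorm (c - y) < e / 2].
  have [||c [[_ [y yN cy]] pc]] := pG N [set c | rnorm (p - c) < e / 4].
  - by exists (~` [set y | rnorm (p - y) < e]).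
  - by apply/nbhs_rnorm; exists (e / 4).
  exfalso; apply: yN => /=.
  have -> : p - y = (p - c) + (c - y) by rewrite addrA subrK.
  apply: (le_lt_trans (ler_rnormD _ _)); move: pc cy => /=; lra.
have Fc : cauchy F.
  apply: cauchy_exP => e e0.
  have [|p pF] := key (complex.Re e); first by rewrite -ltcR RRe_real// realE ltW.
  exists p; apply: filterS pF => y /= py.
  rewrite -ball_normE /ball_/= -rnormE.
  by rewrite -[e]RRe_real ?ltcR// realE ltW.
have [p Fp] := (cvg_ex F).1 (@cauchy_cvg _ F _ Fc).
exists p; split => //.
by apply: (@closed_cvg _ _ F _ id _ _ FT _ Fp); exact: closed_closure.
Qed.

End compact_operators.

Definition calkin (R : realType) (X : completeNormedModType R[i]) : Type :=
  Quotient.quot (@compact_op R X).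

HB.instance Definition _ (R : realType) (X : completeNormedModType R[i]) :=
  @EqQuotient.on (calkin X).
HB.instance Definition _ (R : realType) (X : completeNormedModType R[i]) :=
  GRing.Zmodule.on (calkin X).

Section calkin.
Variables (R : realType) (X : completeNormedModType R[i]).
Implicit Types (S T : bop X) (c d : calkin X).
Local Notation pi := (\pi_(calkin X)).

Lemma calkin_eqP S T : pi S = pi T <-> S - T \in @compact_op R X.
Proof.
split=> [/eqP|ST]; first by rewrite piE Quotient.equivE.
by apply/eqP; rewrite piE Quotient.equivE.
Qed.

Lemma calkin_reprB S : repr (pi S) - S \in @compact_op R X.
Proof. by apply/calkin_eqP; rewrite reprK. Qed.

Lemma calkin_piD S T : pi (S + T) = pi S + pi T.
Proof. by rewrite piE. Qed.

Lemma calkin_pi0 : pi 0 = 0.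
Proof. by rewrite piE. Qed.

Definition calkin_scale (k : R[i]) c : calkin X := pi (k *: repr c).

Lemma calkin_piZ k S : calkin_scale k (pi S) = pi (k *: S).
Proof. by apply/calkin_eqP; rewrite -scalerBr compact_opZ// calkin_reprB. Qed.

Lemma calkin_scalerA k l c :
  calkin_scale k (calkin_scale l c) = calkin_scale (k * l) c.
Proof. by elim/quotW: c => S; rewrite (calkin_piZ l) !calkin_piZ scalerA. Qed.

Lemma calkin_scale1r : left_id 1 calkin_scale.
Proof. by move=> c; rewrite /calkin_scale scale1r reprK. Qed.

Lemma calkin_scalerDr : right_distributive calkin_scale +%R.
Proof.
move=> k; elim/quotW=> S; elim/quotW=> T; rewrite -calkin_piD !calkin_piZ.
by rewrite scalerDr calkin_piD.
Qed.

Lemma calkin_scalerDl c : {morph calkin_scale^~ c : k l / k + l}.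
Proof.
by elim/quotW: c => S k l; rewrite !calkin_piZ scalerDl calkin_piD.
Qed.

HB.instance Definition _ := GRing.Zmodule_isLmodule.Build R[i] (calkin X)
  calkin_scalerA calkin_scale1r calkin_scalerDr calkin_scalerDl.

Lemma calkin_pi_scale k S : k *: pi S = pi (k *: S).
Proof. exact: calkin_piZ. Qed.

Let reps c : set R := [set opnorm S | S in [set S | pi S = c]].

Definition calkin_rnorm c : R :=
  inf [set opnorm S | S in [set S | pi S = c]].

Let reps_has_inf c : has_inf (reps c).
Proof.
split; first by exists (opnorm (repr c)), (repr c) => //=; rewrite reprK.
by exists 0 => _ [S _ <-]; exact: opnorm_ge0.
Qed.

Lemma calkin_rnorm_le S : calkin_rnorm (pi S) <= opnorm S.
Proof. by apply: ge_inf; [exact: (reps_has_inf _).2|exists S]. Qed.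

Lemma calkin_rnorm_ge0 c : 0 <= calkin_rnorm c.
Proof.
apply: lb_le_inf; first exact: (reps_has_inf c).1.
by move=> _ [S _ <-]; exact: opnorm_ge0.
Qed.

Lemma calkin_rnorm_lift c (e : R) : 0 < e ->
  exists2 S, pi S = c & opnorm S < calkin_rnorm c + e.
Proof.
by move=> e0; have [_ [S Sc <-] Se] := inf_adherent e0 (reps_has_inf c); exists S.
Qed.

Let opnormE S : (opnorm S)%:C = `|S|. Proof. by []. Qed.

Let opnormD S T : opnorm (S + T) <= opnorm S + opnorm T.
Proof. by rewrite -lecR rmorphD/= !opnormE ler_normD. Qed.

Let opnormM S T : opnorm (S * T) <= opnorm S * opnorm T.
Proof. by rewrite -lecR rmorphM/= !opnormE nalg_normrM_le. Qed.

Let opnormZ k S : opnorm (k *: S) = normc k * opnorm S.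
Proof. by apply: complexI; rewrite rmorphM/= !opnormE normrZ. Qed.

Let normc_ge0 (k : R[i]) : 0 <= normc k.
Proof. by case: k => ? ?; exact: sqrtr_ge0. Qed.

Definition calkin_norm c : R[i] := (calkin_rnorm c)%:C.

Lemma calkin_normD c d : calkin_norm (c + d) <= calkin_norm c + calkin_norm d.
Proof.
rewrite /calkin_norm -rmorphD/= lecR; apply/ler_addgt0Pr => e e0.
have e20 : 0 < e / 2 by rewrite divr_gt0.
have [S Sc Se] := calkin_rnorm_lift c e20.
have [T Td Te] := calkin_rnorm_lift d e20.
rewrite -{1}Sc -{1}Td -calkin_piD.
apply: (le_trans (calkin_rnorm_le _)); apply: (le_trans (opnormD _ _)).
by rewrite [e]splitr addrACA lerD// ltW.
Qed.

Lemma calkin_normZ k c : calkin_norm (k *: c) = `|k| * calkin_norm c.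
Proof.
have le1 l d : calkin_rnorm (l *: d) <= normc l * calkin_rnorm d.
  have [->|l0] := eqVneq l 0.
    rewrite scale0r -calkin_pi0 normc0 mul0r.
    apply: (le_trans (calkin_rnorm_le _)).
    by rewrite -(scale0r (0 : bop X)) opnormZ normc0 mul0r.
  have lgt0 : 0 < normc l.
    by rewrite lt_def normc_ge0 andbT; apply/eqP => /eq0_normc; exact/eqP.
  rewrite -ler_pdivrMl//; apply: lb_le_inf; first exact: (reps_has_inf d).1.
  move=> _ [S <- <-]; rewrite ler_pdivrMl// -opnormZ.
  rewrite calkin_pi_scale.
  exact: calkin_rnorm_le.
rewrite /calkin_norm; suff -> : calkin_rnorm (k *: c) = normc k * calkin_rnorm c.
  exact: rmorphM.
apply/eqP; rewrite eq_le le1 /=.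
have [->|k0] := eqVneq k 0; first by rewrite normc0 mul0r calkin_rnorm_ge0.
have kgt0 : 0 < normc k.
  by rewrite lt_def normc_ge0 andbT; apply/eqP => /eq0_normc; exact/eqP.
rewrite mulrC -ler_pdivlMr// mulrC -normcV.
by apply: le_trans (le1 _ _); rewrite scalerA mulVf// scale1r.
Qed.

Lemma calkin_norm0_eq0 c : calkin_norm c = 0 -> c = 0.
Proof.
move=> [c0]; rewrite -[c]reprK -calkin_pi0; apply/calkin_eqP; rewrite subr0.
apply: compact_op_closed => e e0.
have [S Sc] := calkin_rnorm_lift c e0; rewrite c0 add0r => Se.
exists (repr c - S); last by rewrite subKr.
by apply/calkin_eqP; rewrite reprK Sc.
Qed.

HB.instance Definition _ := Lmodule_isNormed.Build R[i] (calkin X)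
  calkin_normD calkin_normZ calkin_norm0_eq0.

Definition calkin_one : calkin X := pi 1.
Definition calkin_mul c d : calkin X := pi (repr c * repr d).

Lemma calkin_piM S T : calkin_mul (pi S) (pi T) = pi (S * T).
Proof.
apply/calkin_eqP.
have -> : repr (pi S) * repr (pi T) - S * T =
    (repr (pi S) - S) * repr (pi T) + S * (repr (pi T) - T).
  by rewrite mulrBl mulrBr addrA subrK.
apply: rpredD; first by apply: compact_opMr; exact: calkin_reprB.
by apply: compact_opMl; exact: calkin_reprB.
Qed.

Lemma calkin_mulA : associative calkin_mul.
Proof.
elim/quotW=> S; elim/quotW=> T; elim/quotW=> U.
by rewrite (calkin_piM T U) (calkin_piM S T) !calkin_piM mulrA.
Qed.

Lemma calkin_mul1r : left_id calkin_one calkin_mul.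
Proof. by elim/quotW=> S; rewrite calkin_piM mul1r. Qed.

Lemma calkin_mulr1 : right_id calkin_one calkin_mul.
Proof. by elim/quotW=> S; rewrite calkin_piM mulr1. Qed.

Lemma calkin_mulrDl : left_distributive calkin_mul +%R.
Proof.
elim/quotW=> S; elim/quotW=> T; elim/quotW=> U.
by rewrite -calkin_piD !calkin_piM mulrDl calkin_piD.
Qed.

Lemma calkin_mulrDr : right_distributive calkin_mul +%R.
Proof.
elim/quotW=> S; elim/quotW=> T; elim/quotW=> U.
by rewrite -calkin_piD !calkin_piM mulrDr calkin_piD.
Qed.

Lemma calkin_scalerAl k c d : k *: calkin_mul c d = calkin_mul (k *: c) d.
Proof.
elim/quotW: c => S; elim/quotW: d => T.
by rewrite calkin_piM !calkin_pi_scale calkin_piM; congr (pi _); exact: bopP.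
Qed.

Lemma calkin_scalerAr k c d : k *: calkin_mul c d = calkin_mul c (k *: d).
Proof.
elim/quotW: c => S; elim/quotW: d => T.
rewrite calkin_piM !calkin_pi_scale calkin_piM; congr (pi _).
exact: bop_scaleAr.
Qed.

Lemma calkin_normM c d : `|calkin_mul c d| <= `|c| * `|d|.
Proof.
suff: calkin_rnorm (calkin_mul c d) <= calkin_rnorm c * calkin_rnorm d.
  by rewrite -lecR rmorphM.
have le1 S T : calkin_rnorm (calkin_mul (pi S) (pi T)) <= opnorm S * opnorm T.
  by rewrite calkin_piM (le_trans (calkin_rnorm_le _)).
have le2 S : calkin_rnorm (calkin_mul (pi S) d) <= opnorm S * calkin_rnorm d.
  have [S0|S0] := eqVneq (opnorm S) 0.
    by rewrite S0 mul0r -[d]reprK (le_trans (le1 _ _))// S0 mul0r.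
  have Sgt0 : 0 < opnorm S by rewrite lt_def S0 opnorm_ge0.
  rewrite -ler_pdivrMl//; apply: lb_le_inf; first exact: (reps_has_inf d).1.
  by move=> _ [T <- <-]; rewrite ler_pdivrMl.
have [d0|d0] := eqVneq (calkin_rnorm d) 0.
  by rewrite d0 mulr0 -[c]reprK (le_trans (le2 _))// d0 mulr0.
have dgt0 : 0 < calkin_rnorm d by rewrite lt_def d0 calkin_rnorm_ge0.
rewrite -ler_pdivrMr//; apply: lb_le_inf; first exact: (reps_has_inf c).1.
by move=> _ [S <- <-]; rewrite ler_pdivrMr.
Qed.

HB.instance Definition _ := NormedModule_isNormedAlgebra.Build R[i] (calkin X)
  calkin_mulA calkin_mul1r calkin_mulr1 calkin_mulrDl calkin_mulrDr
  calkin_scalerAl calkin_scalerAr calkin_normM.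
HB.instance Definition _ :=
  GRing.PzRing.copy (calkin X) (NormedAlgebra.sort (calkin X)).

End calkin.

Section l1.
Variable R : realType.

Definition abs_summable : {pred nat -> R[i]} := fun a =>
  `[< cvgn (series (fun k => normc (a k))) >].

Implicit Types a b c : nat -> R[i].

Let normc_ge0 (k : R[i]) : 0 <= normc k.
Proof. by case: k => ? ?; exact: sqrtr_ge0. Qed.

Let nd a : nondecreasing_seq (series (fun k => normc (a k))).
Proof. by apply: nondecreasing_series => n _ _; exact: normc_ge0. Qed.

Let abs_summable_ub a (M : R) :
  (forall n, series (fun k => normc (a k)) n <= M) -> a \in abs_summable.
Proof.
move=> aM; apply/asboolP; apply: nondecreasing_is_cvgn; first exact: nd.
by exists M => _ [n _ <-].
Qed.

Let series_le_lim a n : a \in abs_summable ->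
  series (fun k => normc (a k)) n <= limn (series (fun k => normc (a k))).
Proof. by move=> /asboolP ca; apply: nondecreasing_cvgn_le => //; exact: nd. Qed.

Let lim_le a (M : R) : a \in abs_summable ->
  (forall n, series (fun k => normc (a k)) n <= M) ->
  limn (series (fun k => normc (a k))) <= M.
Proof. by move=> /asboolP ca aM; apply: limr_le => //; apply: nearW. Qed.

Lemma abs_summable_submod : submod_closed abs_summable.
Proof.
split=> [|k a b asum bsum].
  apply: (@abs_summable_ub _ 0) => n; rewrite /series/= big1// => i _.
  exact: normc0.
apply: (@abs_summable_ub _ (normc k * limn (series (fun k => normc (a k))) +
  limn (series (fun k => normc (b k))))) => n.
apply: (@le_trans _ _ (normc k * series (fun k => normc (a k)) n +
  series (fun k => normc (b k)) n)); last first.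
  by rewrite lerD ?ler_wpM2l ?series_le_lim.
rewrite /series/= mulr_sumr -big_split/=; apply: ler_sum => i _.
by rewrite -normcM le_normcD.
Qed.

HB.instance Definition _ := GRing.isSubmodClosed.Build R[i] (nat -> R[i])
  abs_summable abs_summable_submod.

Record l1 := L1 { l1_fun :> nat -> R[i] ; l1_subproof : l1_fun \in abs_summable }.

HB.instance Definition _ := [isSub for l1_fun].
HB.instance Definition _ := [Choice of l1 by <:].
HB.instance Definition _ := [SubChoice_isSubLmodule of l1 by <:].

Implicit Types u v w : l1.

Lemma l1P u v : u =1 v -> u = v.
Proof. by move=> uv; apply/val_inj/funext. Qed.

Definition l1_rnorm u : R := limn (series (fun k => normc (u k))).

Let partial u n := series (fun k => normc (u k)) n.

Let partial_le u n : partial u n <= l1_rnorm u.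
Proof. exact/series_le_lim/l1_subproof. Qed.

Let l1_rnorm_le u M : (forall n, partial u n <= M) -> l1_rnorm u <= M.
Proof. exact/lim_le/l1_subproof. Qed.

Lemma l1_rnorm_ge0 u : 0 <= l1_rnorm u.
Proof. by apply: le_trans (partial_le u 0); rewrite /partial/series/= big_nil. Qed.

Definition l1_norm u : R[i] := (l1_rnorm u)%:C.

Lemma l1_normD u v : l1_norm (u + v) <= l1_norm u + l1_norm v.
Proof.
rewrite /l1_norm -rmorphD/= lecR; apply: l1_rnorm_le => n.
apply: le_trans (lerD (partial_le u n) (partial_le v n)).
rewrite /partial/series/= -big_split/=; apply: ler_sum => i _.
exact: le_normcD.
Qed.

Lemma l1_normZ k u : l1_norm (k *: u) = `|k| * l1_norm u.
Proof.
rewrite /l1_norm; suff -> : l1_rnorm (k *: u) = normc k * l1_rnorm u.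
  exact: rmorphM.
have cu : cvgn (series (fun k => normc (u k))) by exact/asboolP/l1_subproof.
apply/cvg_lim => //.
rewrite (_ : series _ = fun n => normc k * series (fun k => normc (u k)) n).
  exact: cvgM (cvg_cst _) cu.
apply/funext => n; rewrite /series/= mulr_sumr.
by apply: eq_bigr => i _; rewrite -normcM.
Qed.

Lemma l1_norm0_eq0 u : l1_norm u = 0 -> u = 0.
Proof.
move=> [u0]; apply: l1P => k; apply: eq0_normc; apply/eqP.
rewrite eq_le normc_ge0 andbT -u0; apply: le_trans (partial_le u k.+1).
by rewrite /partial/series/= big_nat_recr//= lerDr sumr_ge0// => i _.
Qed.

HB.instance Definition _ :=
  Lmodule_isNormed.Build R[i] l1 l1_normD l1_normZ l1_norm0_eq0.

Definition convolution a b : nat -> R[i] :=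
  fun m => \sum_(k < m.+1) a k * b (m - k)%N.

Let series_convolution (f g : nat -> R) n :
  \sum_(m < n) \sum_(k < m.+1) f k * g (m - k)%N =
  \sum_(k < n) f k * \sum_(j < n - k) g j.
Proof.
elim: n => [|n IH]; first by rewrite !big_ord0.
rewrite big_ord_recr/= IH [RHS]big_ord_recr/= subSnn big_ord1.
rewrite [X in _ + X]big_ord_recr/= subnn addrA; congr (_ + _).
rewrite -big_split/=; apply: eq_bigr => k _.
by rewrite (subSn (ltnW (ltn_ord k))) big_ord_recr/= mulrDr.
Qed.

Let convolution_partial u v n :
  series (fun k => normc (convolution u v k)) n <= l1_rnorm u * l1_rnorm v.
Proof.
apply: (@le_trans _ _ (partial u n * partial v n)); last first.
  by rewrite ler_pM ?partial_le// sumr_ge0.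
rewrite /partial/series/= !big_mkord.
apply: (@le_trans _ _
  (\sum_(m < n) \sum_(k < m.+1) normc (u k) * normc (v (m - k)%N))).
  apply: ler_sum => m _; rewrite /convolution.
  elim/big_ind2: _ => [|x1 x2 y1 y2 h1 h2|k _]; first by rewrite normc0.
    by apply: (le_trans (le_normcD _ _)); rewrite lerD.
  by rewrite normcM.
rewrite (series_convolution (@normc R \o u) (@normc R \o v)) mulr_suml.
apply: ler_sum => k _; rewrite ler_wpM2l//=.
rewrite -(big_mkord xpredT (@normc R \o v)) -(big_mkord xpredT (@normc R \o v)).
rewrite [leRHS](big_cat_nat (leq0n (n - k)) (leq_subr k n))/=.
by rewrite lerDl sumr_ge0.
Qed.

Lemma convolution_summable u v : convolution u v \in abs_summable.
Proof. by apply: abs_summable_ub => n; exact: convolution_partial. Qed.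

Definition l1_mul u v : l1 := L1 (convolution_summable u v).

Lemma l1_one_subproof : (fun m => (m == 0%N)%:R : R[i]) \in abs_summable.
Proof.
apply: (@abs_summable_ub _ 1) => -[|n]; rewrite /series/=.
  by rewrite big_nil.
rewrite big_nat_recl//= big1 => [|i _]; last exact: normc0.
by rewrite expr1n expr0n !addr0 sqrtr1.
Qed.

Definition l1_one : l1 := L1 l1_one_subproof.

Let convolution_poly a b n m : (m < n)%N ->
  convolution a b m = ((\poly_(i < n) a i) * (\poly_(i < n) b i))`_m.
Proof.
move=> mn; rewrite coefM; apply: eq_bigr => k _.
rewrite !coef_poly (leq_ltn_trans (leq_ord k) mn).
by rewrite (leq_ltn_trans (leq_subr k m) mn).
Qed.

Let convolution_ext a a' b b' m :
  (forall i, (i <= m)%N -> a i = a' i) -> (forall i, (i <= m)%N -> b i = b' i) ->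
  convolution a b m = convolution a' b' m.
Proof.
move=> aa' bb'; apply: eq_bigr => k _.
by rewrite aa' ?bb'// ?leq_subr// leq_ord.
Qed.

Let convolution_coef (p q : {poly R[i]}) m :
  convolution (fun i => p`_i) (fun i => q`_i) m = (p * q)`_m.
Proof. by rewrite coefM. Qed.

Lemma l1_mulA : associative l1_mul.
Proof.
move=> u v w; apply: l1P => m /=.
pose P (a : nat -> R[i]) := \poly_(i < m.+1) a i.
have PE a i : (i <= m)%N -> a i = (P a)`_i by move=> im; rewrite coef_poly ltnS im.
have cE a b i : (i <= m)%N -> convolution a b i = (P a * P b)`_i.
  by move=> im; rewrite (@convolution_poly _ _ m.+1).
rewrite (convolution_ext (PE u) (cE v w)) convolution_coef.
by rewrite (convolution_ext (cE u v) (PE w)) convolution_coef mulrA.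
Qed.

Lemma l1_mul1r : left_id l1_one l1_mul.
Proof.
move=> u; apply: l1P => m /=; rewrite /convolution big_ord_recl/= subn0 mul1r.
by rewrite big1 ?addr0// => i _; rewrite mul0r.
Qed.

Lemma l1_mulC : commutative l1_mul.
Proof.
move=> u v; apply: l1P => m /=.
by rewrite !(@convolution_poly _ _ m.+1)// mulrC.
Qed.

Lemma l1_mulr1 : right_id l1_one l1_mul.
Proof. by move=> u; rewrite l1_mulC l1_mul1r. Qed.

Lemma l1_mulrDl : left_distributive l1_mul +%R.
Proof.
move=> u v w; apply: l1P => m.
transitivity (convolution u w m + convolution v w m) => //.
by rewrite -big_split/=; apply: eq_bigr => k _; exact: mulrDl.
Qed.

Lemma l1_mulrDr : right_distributive l1_mul +%R.
Proof. by move=> u v w; rewrite !(l1_mulC u) l1_mulrDl. Qed.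

Lemma l1_scalerAl k u v : k *: l1_mul u v = l1_mul (k *: u) v.
Proof.
apply: l1P => m; transitivity (k * convolution u v m) => //.
by rewrite mulr_sumr; apply: eq_bigr => i _; rewrite mulrA.
Qed.

Lemma l1_scalerAr k u v : k *: l1_mul u v = l1_mul u (k *: v).
Proof. by rewrite l1_mulC l1_scalerAl l1_mulC. Qed.

Lemma l1_normM u v : `|l1_mul u v| <= `|u| * `|v|.
Proof.
suff: l1_rnorm (l1_mul u v) <= l1_rnorm u * l1_rnorm v.
  by rewrite -lecR rmorphM.
by apply: l1_rnorm_le => n; exact: convolution_partial.
Qed.

HB.instance Definition _ := NormedModule_isNormedAlgebra.Build R[i] l1
  l1_mulA l1_mul1r l1_mulr1 l1_mulrDl l1_mulrDr
  l1_scalerAl l1_scalerAr l1_normM.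
HB.instance Definition _ := GRing.PzRing.copy l1 (NormedAlgebra.sort l1).

End l1.

Section indecomposable.
Variables (R : realType) (X : normedModType R[i]).
Implicit Types Y Z : set X.

Definition closed_subspace Y := submod_closed [in Y] /\ closed Y.

(* For a linear subspace Y: Y has a finite spanning family. *)
Definition finite_dimensional Y :=
  exists (n : nat) (e : 'I_n -> X), (forall i, Y (e i)) /\
    forall y, Y y -> exists k : 'I_n -> R[i], y = \sum_i k i *: e i.

Definition indecomposable :=
  ~ finite_dimensional [set: X] /\
  ~ exists Y Z : set X,
      [/\ closed_subspace Y, closed_subspace Z,
          ~ finite_dimensional Y /\ ~ finite_dimensional Z,
          [set y + z | y in Y & z in Z] = [set: X] &
          Y `&` Z = [set 0]].

End indecomposable.

Arguments indecomposable {R} X.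

(* Main.v *)
Require Import Defs.
From mathcomp Require Import all_boot all_order all_algebra complex.
From mathcomp Require Import all_classical all_reals all_analysis.
From mathcomp Require Import lra.

(** Write pi for the quotient map from B(X) onto the Calkin algebra, phi for
the isometric isomorphism of the latter onto l1(N_0), and sigma = phi o pi for
the resulting symbol map, a contractive surjective homomorphism whose kernel
is the ideal of compact operators.

Everything rests on how the units of l1(N_0) sit in the algebra.  Regard
elements of l1(N_0) as absolutely convergent power series on the closed disc.
A unit f is joined to the constant f(0) by the path of units f(t z),
0 <= t <= 1, which is uniformly norm-continuous; cutting it into short pieces
writes f as a nonzero scalar times a product of elements at distance less than
1 from the identity ([l1_unit_ind]).  Scalars and elements close to 1 lift along
sigma to invertible operators, the latter by the Neumann series, so every unit
of l1(N_0) is the symbol of an invertible operator ([symbol_unit_lift]).  This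
takes the place of the statement that Fredholm operators on X have index 0.

Dedekind-finiteness: let b a = 1 and p = a b.  As l1(N_0) is commutative, the
symbol of a is a unit, so a = V + K with V invertible and K compact.  The
operator V^-1 a is a left invertible compact perturbation of the identity, so
by Riesz theory it is invertible ([fredholm_alternative]).  Hence a is
invertible and p = 1.

Failure of stable rank one: the coordinate function z = delta_1 has distance
at least 1 from the units of l1(N_0) ([l1_shift_not_unit]), and sigma is
contractive and maps units to units, so an operator with symbol z has distance
at least 1 from the invertible operators. *)

Set Implicit Arguments.
Unset Strict Implicit.
Unset Printing Implicit Defensive.

Import Order.TTheory GRing.Theory Num.Theory numFieldNormedType.Exports.
Import ComplexField.Normc.

Local Open Scope classical_set_scope.
Local Open Scope quotient_scope.
Local Open Scope ring_scope.
Local Open Scope complex_scope.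

(** * Complex normed spaces *)

Lemma normc_ge0 (R : rcfType) (k : R[i]) : 0 <= normc k.
Proof. by case: k => ? ?; exact: sqrtr_ge0. Qed.

Section normed_space.
Variables (R : realType) (V : normedModType R[i]).
Implicit Types x y : V.

Lemma rnorm_distrC x y : rnorm (x - y) = rnorm (y - x).
Proof. by rewrite -rnormN opprB. Qed.

Lemma ler_rnorm_distD z x y : rnorm (x - y) <= rnorm (x - z) + rnorm (z - y).
Proof. by apply: le_trans (ler_rnormD _ _); rewrite addrA subrK. Qed.

Lemma nbhs_rnorm_lt x (e : R) : 0 < e ->
  nbhs x [set y | rnorm (x - y) < e].
Proof.
move=> e0; apply/nbhs_ballP; exists e%:C => /=; first by rewrite ltcR.
by move=> y; rewrite -ball_normE /ball_/= -rnormE ltcR.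
Qed.

Lemma rnorm_eq0_lt x : (forall e : R, 0 < e -> rnorm x < e) -> x = 0.
Proof.
move=> x0; apply: rnorm_eq0; apply/eqP; rewrite eq_le rnorm_ge0 andbT.
by apply/ler_addgt0Pr => e /x0; rewrite add0r => /ltW.
Qed.

End normed_space.

Lemma rnormM_le (R : realType) (A : normedAlgType R[i]) (x y : A) :
  rnorm (x * y) <= rnorm x * rnorm y.
Proof. by rewrite -lecR rmorphM/= !rnormE nalg_normrM_le. Qed.

(** * Invertible operators near the identity *)

Section neumann.
Variables (R : realType) (X : completeNormedModType R[i]).

Lemma expr_small (q C e : R) : 0 <= q -> q < 1 -> 0 < e ->
  exists n, q ^+ n * C < e.
Proof.
move=> q0 q1 e0; have q1' : `|q| < 1 by rewrite ger0_norm.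
have /cvgrPdist_lt/(_ _ e0)[n _ /(_ n (leqnn n))]/= := cvg_geometric C q1'.
by rewrite sub0r normrN mulrC => /(le_lt_trans (ler_norm _)) ?; exists n.
Qed.

(** Banach's fixed point theorem for the real-valued norm of a complex space.
If D = |s 0 - s 1| / (1 - q), then D is the solution of
|s 0 - s 1| + q D = D, so an induction bounds |s 0 - s m| by D for all
m, and contracting n times bounds |s n - s (n + m)| by q^n D. *)
Lemma contraction_fixpoint (f : X -> X) (q : R) : 0 <= q -> q < 1 ->
  (forall x y, rnorm (f x - f y) <= q * rnorm (x - y)) -> exists x, f x = x.
Proof.
move=> q0 q1 fq; pose s n := iter n f 0.
pose D := rnorm (s 0%N - s 1%N) / (1 - q).
have DE : rnorm (s 0%N - s 1%N) + q * D = D.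
  by rewrite -[X in X + _](@divfK _ (1 - q)) -/D ?subr_eq0 ?gt_eqF//; lra.
have D0 m : rnorm (s 0%N - s m) <= D.
  elim: m => [|m IH].
    by rewrite subrr rnorm0 divr_ge0 ?rnorm_ge0// subr_ge0 ltW.
  apply: (le_trans (ler_rnorm_distD (s 1%N) _ _)); rewrite -[leRHS]DE lerD2l.
  by apply: (le_trans (fq _ _)); rewrite ler_wpM2l.
have Dn n m : rnorm (s n - s (n + m)%N) <= q ^+ n * D.
  elim: n => [|n IH]; first by rewrite expr0 mul1r; exact: D0.
  by rewrite addSn exprS -mulrA; apply: (le_trans (fq _ _)); rewrite ler_wpM2l.
have sc : cauchy (s @ \oo).
  apply: cauchy_exP => e e0.
  have er : e = (complex.Re e)%:C by rewrite RRe_real// realE ltW.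
  have r0 : 0 < complex.Re e by rewrite -ltcR -er.
  have [n nD] := expr_small D q0 q1 r0.
  exists (s n); exists n => // m /= nm.
  rewrite -ball_normE /ball_/= -rnormE er ltcR.
  by rewrite -(subnKC nm); exact: le_lt_trans (Dn _ _) nD.
have [x sx] := (cvg_ex _).1 (@cauchy_cvg _ (s @ \oo) _ sc).
exists x; apply/eqP; rewrite -subr_eq0; apply/eqP.
apply: rnorm_eq0_lt => e e0; have e20 : 0 < e / 2 by rewrite divr_gt0.
have [n _ nx] := sx _ (nbhs_rnorm_lt x e20).
have h1 := nx n (leqnn n); have h2 := nx n.+1 (leqnSn n).
apply: (le_lt_trans (ler_rnorm_distD (s n.+1) _ _)).
have := fq x (s n); move: h1 h2 => /= h1 h2 h3.
have h4 := ler_wpM2r (rnorm_ge0 (x - s n)) (ltW q1).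
rewrite (rnorm_distrC _ x) [e]splitr ltrD//.
by apply: le_lt_trans h1; apply: (le_trans h3); rewrite -[leRHS]mul1r.
Qed.

(** A bounded below surjection is invertible: the lower bound gives both the
injectivity and the boundedness of the inverse map. *)
Lemma bop_bijective_inv (T : bop X) (M : R) :
  (forall x, rnorm x <= M * rnorm (T x)) -> (forall y, exists x, T x = y) ->
  inv_group T.
Proof.
move=> TM /choice[g gK].
have Tinj x y : T x = T y -> x = y.
  move=> Txy; apply/eqP; rewrite -subr_eq0; apply/eqP/rnorm_eq0/eqP.
  rewrite eq_le rnorm_ge0 andbT (le_trans (TM _))//.
  by rewrite bopB Txy subrr rnorm0 mulr0.
have gb : g \in @bounded_op R X.
  apply/asboolP; split=> [k x y|].
    by apply: Tinj; rewrite bop_linear !gK.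
  by exists M => y; rewrite -{2}(gK y); exact: TM.
exists (Bop gb); split; apply: bopP => x /=; rewrite ?gK//.
by apply: Tinj; rewrite gK.
Qed.

(** The equation x + U x = y says that x is a fixed point of the contraction
x |-> y - U x, and |x + U x| >= (1 - |U|) |x| bounds the inverse. *)
Lemma neumann_inv (U : bop X) : opnorm U < 1 -> inv_group (1 + U).
Proof.
move=> U1; have U1' : 0 < 1 - opnorm U by rewrite subr_gt0.
apply: (@bop_bijective_inv _ (1 - opnorm U)^-1) => [x|y].
  rewrite mulrC ler_pdivlMr// mulrBr mulr1 lerBlDr mulrC.
  apply: le_trans (lerD (lexx _) (opnormP U x)).
  rewrite -(rnormN (U x)); apply: le_trans (ler_rnormD _ _).
  by rewrite bop_addE bop_oneE addrK.
have [||x xf] := @contraction_fixpoint (fun x => y - U x) (opnorm U) _ U1.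
- exact: opnorm_ge0.
- move=> a b; rewrite opprB addrC addrA subrK -bopB (rnorm_distrC a).
  exact: opnormP.
by exists x; rewrite bop_addE bop_oneE -{1}xf subrK.
Qed.

End neumann.

(** * Compact perturbations of the identity *)

Section riesz.
Variables (R : realType) (X : completeNormedModType R[i]).

(** The form in which compactness is used: the image of a bounded sequence has
a cluster point, near which infinitely many of its terms accumulate. *)
Lemma compact_op_clustering (K : bop X) (y : nat -> X) (e : R) :
  K \in @compact_op R X -> (forall n, rnorm (y n) <= 1) -> 0 < e ->
  exists n m, (n < m)%N /\ rnorm (K (y n) - K (y m)) < e.
Proof.
move=> /asboolP Kc y1 e0; have e20 : 0 < e / 2 by rewrite divr_gt0.
pose F := (fun n => K (y n)) @ \oo.
have [|p [_ pF]] := Kc F _.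
  by exists 0%N => // n _; apply: subset_closure; exists (y n) => //; exact: y1.
have far N : exists2 n, (N <= n)%N & rnorm (p - K (y n)) < e / 2.
  have [|_ [[n Nn <-] pn]] := pF [set K (y n) | n in [set n | (N <= n)%N]]
      _ _ (nbhs_rnorm_lt p e20).
    by exists N => // n Nn; exists n.
  by exists n.
have [n _ pn] := far 0%N; have [m nm pm] := far n.+1.
exists n, m; split=> //; apply: (le_lt_trans (ler_rnorm_distD p _ _)).
by rewrite (rnorm_distrC _ p) [e]splitr ltrD.
Qed.

(** Riesz's lemma.  With z in M almost realizing the distance from x to M, the
normalization of x - z is almost orthogonal to M.  Recording this vector as a
multiple of x - z, z in M, keeps it inside any subspace that contains x and
M. *)
Lemma riesz_almost_orthogonal (M : set X) (x : X) (d : R) :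
  M 0 -> (forall k z, M z -> M (k *: z)) ->
  (forall z w, M z -> M w -> M (z + w)) ->
  0 < d -> (forall z, M z -> d <= rnorm (x - z)) ->
  exists k z, [/\ M z, rnorm (k *: (x - z)) <= 1 &
    forall w, M w -> 2^-1 <= rnorm (k *: (x - z) - w)].
Proof.
move=> M0 MZ MD d0 dM.
pose D := [set rnorm (x - z) | z in M].
have Dinf : has_inf D.
  split; first by exists (rnorm (x - 0)), 0.
  by exists d => _ [z Mz <-]; exact: dM.
have dD : d <= inf D by apply: lb_le_inf Dinf.1 _ => _ [z Mz <-]; exact: dM.
have D0 : 0 < inf D by exact: lt_le_trans d0 dD.
have [_ [z Mz <-] zD] := inf_adherent D0 Dinf.
set r := rnorm (x - z) in zD.
have r0 : 0 < r by exact: lt_le_trans d0 (dM _ Mz).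
have rV0 : 0 <= r^-1 by rewrite invr_ge0 ltW.
exists r^-1%:C, z; split=> //; first by rewrite rnormZr// mulVf// gt_eqF.
move=> w Mw.
have -> : r^-1%:C *: (x - z) - w = r^-1%:C *: (x - (z + r%:C *: w)).
  rewrite opprD addrA [RHS]scalerBr; congr (_ - _).
  by rewrite scalerA -rmorphM/= mulVf ?gt_eqF// scale1r.
rewrite rnormZr// mulrC ler_pdivlMr//.
have : inf D <= rnorm (x - (z + r%:C *: w)).
  by apply: ge_inf; [exact: Dinf.2|exists (z + r%:C *: w) => //; auto].
by move: zD; lra.
Qed.

Lemma bop_exprSE (c : bop X) n x : (c ^+ n.+1) x = (c ^+ n) (c x).
Proof. by rewrite exprSr. Qed.

(** If c were not surjective, the ranges of the powers c^n would decrease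
strictly, because c has a left inverse.  Riesz's lemma then yields vectors y n
of norm at most 1 in the range of c^n at distance at least 1/2 from the range
of c^(n+1).  For n < m the difference K (y m) - K (y n), where K = c - 1, is y n
minus an element of the latter range, so its norm is at least 1/2; hence K is
not compact. *)
Lemma fredholm_alternative (b c : bop X) :
  b * c = 1 -> c - 1 \in @compact_op R X -> c * b = 1.
Proof.
move=> bc cK; apply: contrapT => cb.
(* e is the projection along the range of c. *)
pose e := 1 - c * b.
have [v ev] : exists v, e v != 0.
  apply: contrapT => e0; apply: cb; apply/esym/eqP; rewrite -subr_eq0.
  apply/eqP/bopP => x; apply/eqP/negPn/negP => ex; apply: e0.
  by exists x.
have ec : e * c = 0 by rewrite mulrBl mul1r -mulrA bc mulr1 subrr.
have bcn n : b ^+ n * c ^+ n = 1.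
  elim: n => [|n IH]; first by rewrite mulr1.
  by rewrite exprSr exprS mulrA -(mulrA _ b) bc mulr1.
pose M n : set X := range (c ^+ n.+1).
have step n : exists u, rnorm ((c ^+ n) u) <= 1 /\
    forall w, 2^-1 <= rnorm ((c ^+ n) u - (c ^+ n.+1) w).
  (* The operator e b^n kills c^(n+1) w and maps c^n v to e v <> 0, which bounds
     the distance from c^n v to the range of c^(n+1) from below. *)
  pose d := rnorm (e v) / (opnorm (e * b ^+ n) + 1).
  have C0 : 0 < opnorm (e * b ^+ n) + 1 by rewrite ltr_wpDl ?opnorm_ge0.
  have [|||||k [z [Mz k1 k2]]] :=
      @riesz_almost_orthogonal (M n) ((c ^+ n) v) d.
  - by exists 0 => //; rewrite bop0.
  - by move=> k _ [w _ <-]; exists (k *: w) => //; rewrite bopZ.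
  - by move=> _ _ [w _ <-] [w' _ <-]; exists (w + w') => //; rewrite bopD.
  - rewrite divr_gt0// lt_def rnorm_ge0 andbT.
    by apply/eqP => /rnorm_eq0; exact/eqP.
  - move=> _ [w _ <-]; rewrite ler_pdivrMr//.
    have -> : e v = (e * b ^+ n) ((c ^+ n) v - (c ^+ n.+1) w).
      rewrite bopB -!bop_mulE -!mulrA bcn mulr1 exprSr (mulrA _ (c ^+ n)) bcn.
      by rewrite mul1r ec subr0.
    apply: (le_trans (opnormP _ _)); rewrite mulrC ler_wpM2l ?rnorm_ge0//.
    by rewrite lerDl.
  case: Mz k1 k2 => w _ <- k1 k2.
  exists (k *: (v - c w)).
  rewrite bopZ bopB -bop_exprSE; split=> // w'.
  by apply: k2; exists w'.
have [u uP] := choice step.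
pose y n := (c ^+ n) (u n).
have half0 : 0 < 2^-1 :> R by [].
have [n [m [nm]]] := @compact_op_clustering (c - 1) y _ cK
  (fun n => (uP n).1) half0.
apply/negP; rewrite -leNgt.
have [k ->] : exists k, m = (n.+1 + k)%N by exists (m - n.+1)%N; rewrite subnKC.
rewrite rnorm_distrC /y.
set t := u (n.+1 + k)%N.
have KE j x : (c - 1) ((c ^+ j) x) = (c ^+ j.+1) x - (c ^+ j) x.
  by rewrite exprS.
rewrite !KE.
(* With K = c - 1, K (y m) - K (y n) = c^n (u n) - c^(n+1) w for this w. *)
have := (uP n).2 (u n - (c ^+ k.+1) t + (c ^+ k) t).
rewrite bopD bopB -!bop_mulE -!exprD addnS !opprD !opprK !addrA.
congr (_ <= rnorm _).
rewrite [LHS]addrC !addrA [LHS]addrC !addrA; exact: addrAC.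
Qed.

End riesz.

(** * The units of the convolution algebra *)

Section l1_norm.
Variable R : realType.
Implicit Types f g u v w : l1 R.

Lemma abs_summable_bounded (a : nat -> R[i]) (M : R) :
  (forall n, \sum_(k < n) normc (a k) <= M) -> a \in @abs_summable R.
Proof.
move=> aM; apply/asboolP; apply: nondecreasing_is_cvgn.
  by apply: nondecreasing_series => n _ _; exact: normc_ge0.
by exists M => _ [n _ <-]; rewrite /series/= big_mkord.
Qed.

Lemma l1_partial_cvg f : (fun n => \sum_(k < n) normc (f k)) @ \oo --> rnorm f.
Proof.
have -> : (fun n => \sum_(k < n) normc (f k)) = series (fun k => normc (f k)).
  by apply/funext => n; rewrite /series/= big_mkord.
exact/asboolP/l1_subproof.
Qed.

Lemma l1_partial_nd f : nondecreasing_seq (fun n => \sum_(k < n) normc (f k)).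
Proof.
move=> m n mn; rewrite -!(big_mkord xpredT (fun k => normc (f k))).
rewrite [leRHS](big_cat_nat (leq0n m) mn)/= lerDl.
by apply: sumr_ge0 => k _; exact: normc_ge0.
Qed.

Lemma l1_partial_le f n : \sum_(k < n) normc (f k) <= rnorm f.
Proof.
have fc := @l1_partial_cvg f.
rewrite -(cvg_lim _ fc)//; apply: nondecreasing_cvgn_le.
  exact: l1_partial_nd.
by apply/cvg_ex; exists (rnorm f).
Qed.

Lemma l1_norm_le f (M : R) :
  (forall n, \sum_(k < n) normc (f k) <= M) -> rnorm f <= M.
Proof.
move=> fM; have fc := @l1_partial_cvg f.
rewrite -(cvg_lim _ fc)//; apply: limr_le; last by apply: nearW.
by apply/cvg_ex; exists (rnorm f).
Qed.

Lemma l1_mulE f g n : (f * g) n = \sum_(k < n.+1) f k * g (n - k)%N.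
Proof. by []. Qed.

Lemma l1_oneE n : (1 : l1 R) n = (n == 0%N)%:R.
Proof. by []. Qed.

Lemma l1_addE f g n : (f + g) n = f n + g n.
Proof. by []. Qed.

Lemma l1_oppE f n : (- f) n = - f n.
Proof. by []. Qed.

Lemma l1_scaleE (k : R[i]) f n : (k *: f) n = k * f n.
Proof. by []. Qed.

Lemma l1_shift_subproof :
  (fun m => (m == 1%N)%:R : R[i]) \in @abs_summable R.
Proof.
apply: (@abs_summable_bounded _ 1) => n.
have [n1|n1] := ltnP 1 n.
  rewrite (bigD1 (Ordinal n1))//= big1 => [|i i1].
    by rewrite expr1n expr0n !addr0 sqrtr1.
  rewrite (_ : (i == 1%N :> nat) = false) ?normc0//; exact/negbTE.
rewrite big1 ?ler01// => i _.
by rewrite ltn_eqF ?normc0// (leq_trans (ltn_ord i)).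
Qed.

(** The coordinate function z, that is the sequence delta_1. *)
Definition l1_shift : l1 R := L1 l1_shift_subproof.

Lemma l1_shiftM f n : (l1_shift * f) n.+1 = f n.
Proof.
rewrite l1_mulE 2!big_ord_recl/= mul0r add0r mul1r subn1 big1 ?addr0//.
by move=> i _; rewrite mul0r.
Qed.

(** Let u = h - z have norm less than 1 and suppose h w = 1.  The backward shift
is contractive and maps z w to w and 1 to 0; applied to z w + u w = 1 it gives
|w| <= |u w| <= |u| |w|, which forces w = 0. *)
Lemma l1_shift_not_unit h : rnorm (h - l1_shift) < 1 -> ~ inv_group h.
Proof.
move=> hd [w [hw _]].
set u := h - l1_shift in hd.
have wE n : normc (w n) = normc ((u * w) n.+1).
  rewrite /u mulrBl l1_addE l1_oppE hw l1_shiftM l1_oneE/= sub0r.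
  by rewrite normcN.
have ww : rnorm w <= rnorm u * rnorm w.
  apply: le_trans (rnormM_le _ _); apply: l1_norm_le => n.
  apply: le_trans (l1_partial_le (u * w) n.+1).
  rewrite big_ord_recl/= ler_wpDl ?normc_ge0//.
  by apply: ler_sum => i _; rewrite wE.
have w0 : w = 0.
  apply: rnorm_eq0; apply/eqP; rewrite eq_le rnorm_ge0 andbT.
  have := rnorm_ge0 w; move: ww hd; nra.
have /eqP := congr1 (fun f : l1 R => f 0%N) hw.
by rewrite w0 mulr0 l1_oneE/= eq_sym oner_eq0.
Qed.

End l1_norm.

Section dilation.
Variable R : realType.
Implicit Types (s t : R) (f g : l1 R).

Lemma normcX (z : R[i]) n : normc (z ^+ n) = normc z ^+ n.
Proof. by elim: n => [|n IH]; rewrite ?normc1// !exprS normcM IH. Qed.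

Lemma normc_real t : normc t%:C = `|t|.
Proof. by rewrite /= expr0n addr0 sqrtr_sqr. Qed.

(** On power series this is f(z) |-> f(t z); for 0 <= t <= 1 the coefficients of
f dominate those of its image. *)
Lemma l1_dilation_ex t f : exists g : l1 R,
  0 <= t <= 1 -> forall k, g k = t%:C ^+ k * f k.
Proof.
have [/andP[t0 t1]|_] := boolP (0 <= t <= 1); last by exists 0.
suff tf : (fun k => t%:C ^+ k * f k) \in @abs_summable R by exists (L1 tf).
apply: (@abs_summable_bounded _ _ (rnorm f)) => n.
apply: le_trans (l1_partial_le f n); apply: ler_sum => i _.
rewrite normcM normcX normc_real ger0_norm// ler_piMl ?normc_ge0//.
exact: exprn_ile1.
Qed.

(** Chosen for all t, but only its values for 0 <= t <= 1 are meaningful. *)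
Definition l1_dilation t f : l1 R := sval (cid (l1_dilation_ex t f)).

Lemma l1_dilationE t f k : 0 <= t <= 1 -> l1_dilation t f k = t%:C ^+ k * f k.
Proof. by move=> t01; exact: (svalP (cid (l1_dilation_ex t f))). Qed.

Lemma l1_dilation1 f : l1_dilation 1 f = f.
Proof.
by apply: l1P => k; rewrite l1_dilationE ?ler01 ?lexx// expr1n mul1r.
Qed.

Lemma l1_dilation0 f : l1_dilation 0 f = f 0%N *: (1 : l1 R).
Proof.
apply: l1P => -[|k]; rewrite l1_dilationE ?ler01 ?lexx// l1_scaleE l1_oneE.
  by rewrite mulr1 mul1r.
by rewrite mulr0 expr0n mul0r.
Qed.

Lemma l1_dilation_one t : 0 <= t <= 1 -> l1_dilation t 1 = 1.
Proof.
move=> t01; apply: l1P => -[|k]; rewrite l1_dilationE// l1_oneE ?mulr0//.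
by rewrite mulr1.
Qed.

Lemma l1_dilationM t f g : 0 <= t <= 1 ->
  l1_dilation t (f * g) = l1_dilation t f * l1_dilation t g.
Proof.
move=> t01; apply: l1P => n; rewrite l1_dilationE// !l1_mulE mulr_sumr.
apply: eq_bigr => k _; rewrite !l1_dilationE// mulrACA -exprD subnKC//.
by rewrite -ltnS.
Qed.

Lemma exprn_lipschitz s t k : 0 <= s <= 1 -> 0 <= t <= 1 ->
  `|s ^+ k - t ^+ k| <= k%:R * `|s - t|.
Proof.
move=> /andP[s0 s1] /andP[t0 t1]; rewrite subrXX normrM mulrC.
rewrite ler_wpM2r//; apply: le_trans (ler_norm_sum _ _ _) _.
rewrite -[leRHS]mulr1 -[k in leRHS]card_ord mulr_natl -sumr_const.
apply: ler_sum => i _; rewrite normrM !normrX !ger0_norm//.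
by rewrite mulr_ile1 ?exprn_ge0 ?exprn_ile1.
Qed.

(** All but finitely many coefficients contribute at most e/2, uniformly in s
and t; on the others t |-> t^k is Lipschitz. *)
Lemma l1_dilation_unif_cont f (e : R) : 0 < e -> exists2 d : R, 0 < d &
  forall s t, 0 <= s <= 1 -> 0 <= t <= 1 -> `|s - t| < d ->
    rnorm (l1_dilation s f - l1_dilation t f) <= e.
Proof.
move=> e0; have e20 : 0 < e / 2 by rewrite divr_gt0.
have /cvgrPdist_lt/(_ _ e20)[M _ /(_ M (leqnn M))/=] := @l1_partial_cvg R f.
rewrite ger0_norm ?subr_ge0 ?l1_partial_le// => fM.
have C0 : 0 < M%:R * rnorm f + 1 :> R by rewrite ltr_wpDl ?mulr_ge0 ?rnorm_ge0.
exists (e / 2 / (M%:R * rnorm f + 1)); first exact: divr_gt0.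
move=> s t s01 t01 st; apply: l1_norm_le => n.
apply: le_trans (@l1_partial_nd R _ _ _ (leq_addl M n)) _.
have E k : normc ((l1_dilation s f - l1_dilation t f) k) =
    `|s ^+ k - t ^+ k| * normc (f k).
  rewrite l1_addE l1_oppE !l1_dilationE// -mulrBl normcM.
  have -> : s%:C ^+ k - t%:C ^+ k = (s ^+ k - t ^+ k)%:C.
    by rewrite rmorphB !rmorphXn.
  by rewrite normc_real.
rewrite big_split_ord/= [e]splitr lerD//.
  apply: (@le_trans _ _ (M%:R * `|s - t| * \sum_(k < M) normc (f k))).
    rewrite mulr_sumr; apply: ler_sum => k _; rewrite E ler_wpM2r ?normc_ge0//.
    apply: (le_trans (exprn_lipschitz k s01 t01)).
    by rewrite ler_wpM2r// ler_nat ltnW.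
  apply: (@le_trans _ _ (M%:R * `|s - t| * rnorm f)).
    by rewrite ler_wpM2l ?mulr_ge0// l1_partial_le.
  move: st; rewrite ltr_pdivlMr// mulrDr mulr1 mulrAC mulrC => /ltW.
  by apply: le_trans; rewrite lerDl.
have := l1_partial_le f (M + n); rewrite big_split_ord/= -lerBrDl => tail.
apply: le_trans (le_trans tail (ltW fM)).
apply: ler_sum => k _; rewrite E ler_piMl ?normc_ge0//.
move: s01 t01 => /andP[s0 s1] /andP[t0 t1].
have := exprn_ge0 (M + k) s0; have := exprn_ge0 (M + k) t0.
have := exprn_ile1 (M + k) s0 s1; have := exprn_ile1 (M + k) t0 t1.
by rewrite ler_norml; lra.
Qed.

(** The units are generated by the nonzero scalars and the open unit ball around
1.  If g is the inverse of f, then the dilations of f and g by t are inverse to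
each other; so with f_i the dilation of f by i/(N+1) one has
f_(i+1) = f_i (g_i f_(i+1)), and the second factor is close to 1 when N is
large.  Dilation by 0 leaves the scalar f(0), dilation by 1 leaves f. *)
Lemma l1_unit_ind (P : set (l1 R)) :
  (forall u v, P u -> P v -> P (u * v)) ->
  (forall k : R[i], k != 0 -> P (k *: (1 : l1 R))) ->
  (forall u : l1 R, rnorm (u - 1) < 1 -> P u) ->
  forall f, inv_group f -> P f.
Proof.
move=> PM PZ P1 f [g [fg gf]].
have e0 : 0 < (rnorm g + 1)^-1 by rewrite invr_gt0 ltr_wpDl ?rnorm_ge0.
have [d d0 fd] := l1_dilation_unif_cont f e0.
have [N _ Nd] : exists2 N : nat, True & (N.+1%:R)^-1 < d.
  have /cvgrPdist_lt/(_ _ d0)[N _ /(_ N (leqnn N))/=] := @cvg_harmonic R.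
  by rewrite sub0r normrN ger0_norm// => Nd; exists N.
pose t i : R := i%:R / N.+1%:R.
have t01 i : (i <= N.+1)%N -> 0 <= t i <= 1.
  by move=> iN; rewrite divr_ge0//= ler_pdivrMr// mul1r ler_nat.
rewrite -(l1_dilation1 f) -(divff (_ : N.+1%:R != 0))//.
suff PN i : (i <= N.+1)%N -> P (l1_dilation (t i) f) by exact: PN.
elim: i => [|i IH] iN.
  rewrite /t mul0r l1_dilation0; apply: PZ.
  have := congr1 (fun f : l1 R => f 0%N) fg.
  rewrite l1_mulE big_ord1 l1_oneE/= => /eqP.
  by apply: contraTneq => ->; rewrite mul0r eq_sym oner_eq0.
have ti := t01 _ (ltnW iN); have tSi := t01 _ iN.
have fgi : l1_dilation (t i) f * l1_dilation (t i) g = 1.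
  by rewrite -l1_dilationM// fg l1_dilation_one.
have gfi : l1_dilation (t i) g * l1_dilation (t i) f = 1.
  by rewrite -l1_dilationM// gf l1_dilation_one.
rewrite -[l1_dilation (t i.+1) f]mul1r -fgi -mulrA.
apply: PM; first by apply: IH; exact: ltnW.
apply: P1; rewrite -gfi -mulrBr; apply: (le_lt_trans (rnormM_le _ _)).
have gi : rnorm (l1_dilation (t i) g) <= rnorm g.
  apply: l1_norm_le => n; apply: le_trans (l1_partial_le g n).
  apply: ler_sum => k _; rewrite l1_dilationE// normcM normcX normc_real.
  move: ti => /andP[? ?].
  by rewrite ger0_norm// ler_piMl ?normc_ge0// exprn_ile1.
have : rnorm (l1_dilation (t i.+1) f - l1_dilation (t i) f) <=
    (rnorm g + 1)^-1.
  apply: fd => //; rewrite /t -mulrBl -natrB// subSnn mul1r.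
  by rewrite ger0_norm.
move=> h; apply: (@le_lt_trans _ _ (rnorm g * (rnorm g + 1)^-1)).
  by rewrite ler_pM ?rnorm_ge0.
by rewrite ltr_pdivrMr ?mul1r ?ltrDl// ltr_wpDl ?rnorm_ge0.
Qed.

End dilation.

(** * Lifting units from the Calkin algebra *)

Lemma inv_groupM (A : pzRingType) (x y : A) :
  inv_group x -> inv_group y -> inv_group (x * y).
Proof.
move=> [x' [xx' x'x]] [y' [yy' y'y]]; exists (y' * x'); split.
  by rewrite mulrA -(mulrA x) yy' mulr1.
by rewrite mulrA -(mulrA y') x'x mulr1.
Qed.

Section calkin_l1.
Variables (R : realType) (X : completeNormedModType R[i]).
Variable phi : {rmorphism calkin X -> l1 R}.
Hypothesis phiZ : scalable phi.
Hypothesis phi_bij : bijective phi.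
Hypothesis phi_norm : forall c : calkin X, `|phi c| = `|c|.

(** The Calkin class of an operator, read as a power series. *)
Definition symbol (T : bop X) : l1 R := phi (\pi_(calkin X) T).

Lemma symbolD S T : symbol (S + T) = symbol S + symbol T.
Proof. by rewrite /symbol calkin_piD rmorphD. Qed.

Lemma symbolM S T : symbol (S * T) = symbol S * symbol T.
Proof. by rewrite /symbol -calkin_piM rmorphM. Qed.

Lemma symbol1 : symbol 1 = 1.
Proof. exact: (rmorph1 phi). Qed.

Lemma symbolZ k T : symbol (k *: T) = k *: symbol T.
Proof. by rewrite /symbol -calkin_pi_scale phiZ. Qed.

Lemma symbolB S T : symbol (S - T) = symbol S - symbol T.
Proof. by rewrite symbolD -scaleN1r symbolZ scaleN1r. Qed.

Lemma symbol_eq S T : symbol S = symbol T -> S - T \in @compact_op R X.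
Proof. by move=> /(bij_inj phi_bij)/calkin_eqP. Qed.

Lemma symbol_surj f : exists T, symbol T = f.
Proof.
have [psi _ psiK] := phi_bij.
by exists (repr (psi f)); rewrite /symbol reprK.
Qed.

Lemma rnorm_symbol T : rnorm (symbol T) <= opnorm T.
Proof. by rewrite /rnorm phi_norm; exact: calkin_rnorm_le. Qed.

(** The symbol map is a metric quotient map, by the definition of the quotient
norm. *)
Lemma symbol_lift f (e : R) : rnorm f < e ->
  exists2 T, symbol T = f & opnorm T < e.
Proof.
move=> fe; have [psi _ psiK] := phi_bij.
have e0 : 0 < e - rnorm f by rewrite subr_gt0.
have [T Tf Te] := calkin_rnorm_lift (psi f) e0.
exists T; first by rewrite /symbol Tf.
apply: lt_le_trans Te _; rewrite -lerBrDr opprB addrC subrK.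
by rewrite -{2}(psiK f) /rnorm phi_norm.
Qed.

Lemma inv_group_symbol T : inv_group T -> inv_group (symbol T).
Proof.
by move=> [S [TS ST]]; exists (symbol S); rewrite -!symbolM TS ST symbol1.
Qed.

(** Units lift to units since the generators of the unit group do. *)
Lemma symbol_unit_lift f :
  inv_group f -> exists2 V : bop X, inv_group V & symbol V = f.
Proof.
move: f; apply: l1_unit_ind => [_ _ [V Vu <-] [W Wu <-]|k k0|f f1].
- by exists (V * W); [exact: inv_groupM|exact: symbolM].
- exists (k *: (1 : bop X)); last by rewrite symbolZ symbol1.
  exists (k^-1 *: (1 : bop X)); split; apply: bopP => x.
    by rewrite bop_mulE !bop_scaleE !bop_oneE scalerA mulfV// scale1r.
  by rewrite bop_mulE !bop_scaleE !bop_oneE scalerA mulVf// scale1r.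
have [U Uf U1] := symbol_lift f1.
exists (1 + U); first exact: neumann_inv.
by rewrite symbolD symbol1 Uf addrC subrK.
Qed.

(** From b a = 1 the symbol of a is a unit by commutativity, so a agrees with
an invertible V modulo the compact operators; the left invertible operator
V^-1 a is then invertible. *)
Lemma calkin_l1_dedekind_finite : dedekind_finite (bop X).
Proof.
move=> p _ [a [b [ab ba]]].
have [|V [W [VW WV]] Va] := @symbol_unit_lift (symbol a).
  exists (symbol b); have ba1 : symbol b * symbol a = 1.
    by rewrite -symbolM ba symbol1.
  by split=> //; rewrite -ba1; exact: l1_mulC.
have bVWa : (b * V) * (W * a) = 1 by rewrite mulrA -(mulrA b) VW mulr1.
have WaK : W * a - 1 \in @compact_op R X.
  by rewrite -WV -mulrBr; apply: compact_opMl; exact/symbol_eq.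
have := fredholm_alternative bVWa WaK.
rewrite -mulrA (mulrA a) ab => WpV.
by rewrite -[p]mul1r -[p]mulr1 -VW -!mulrA (mulrA p) (mulrA W) WpV mul1r.
Qed.

(** An invertible operator within distance 1 of an operator with symbol z would
have a symbol that is a unit within distance 1 of z. *)
Lemma calkin_l1_not_stable_rank_one : ~ stable_rank_one (bop X).
Proof.
move=> inv_dense.
have [T Tz] := symbol_surj (l1_shift R).
have [||V [VT Vu]] := inv_dense (ball T 1).
- by exists T; exact: ballxx.
- exact: ball_open.
apply: (@l1_shift_not_unit _ (symbol V)); last exact: inv_group_symbol.
rewrite -Tz -symbolB; apply: (le_lt_trans (rnorm_symbol _)).
move: VT; rewrite -ball_normE /ball_/= -rnormE rnorm_distrC.
by rewrite (_ : 1 = 1%:C)// ltcR.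
Qed.

End calkin_l1.

Theorem theorem2p16 (R : realType) (X : completeNormedModType R[i])
    (X_indecomposable : indecomposable X)
    (X_calkin : isometrically_isomorphic (calkin X) (l1 R)) :
  dedekind_finite (bop X) /\ ~ stable_rank_one (bop X).
Proof.
have [phi [phiZ phi_bij phi_norm]] := X_calkin.
split; first exact: (calkin_l1_dedekind_finite phiZ phi_bij phi_norm).
exact: (calkin_l1_not_stable_rank_one phiZ phi_bij phi_norm).
Qed.
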